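(* Let $\tilde\gamma\in\mathrm{PSL}(n+1,\mathbb{H})$ be a loxodromic element admitting a lift in $\mathrm{SL}(n+1,\mathbb{H})$ of the block diagonal form $$\gamma=\begin{bmatrix}\mathrm{D}(|\lambda_1|,k_1)&&&\\&\mathrm{D}(|\lambda_2|,k_2)&&\\&&\ddots&\\&&&\mathrm{D}(|\lambda_p|,k_p)\end{bmatrix},$$ where $k_1+\cdots+k_p=n+1$ (each $k_i\ge1$), $|\lambda_1|<|\lambda_2|<\cdots<|\lambda_p|$, and $\mathrm{D}(|\lambda_i|,k_i)$ denotes a diagonal block of size $k_i$ all of whose diagonal entries have modulus $|\lambda_i|$. Then the equicontinuity region of the cyclic group $\Gamma:=\langle\tilde\gamma\rangle$ is $$\mathrm{Eq}(\Gamma)=\mathbb{P}^n_{\mathbb{H}}\setminus\big(L\{e_1,e_2,\dots,e_{k_1+\cdots+k_{p-1}}\}\cup L\{e_{k_1+1},e_{k_1+2},\dots,e_{n+1}\}\big).$$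
   Context: $\mathbb{H}$ is the division ring of quaternions; $\mathbb{H}^{n+1}$ is a right $\mathbb{H}$-vector space and $\mathbb{P}^n_{\mathbb{H}}=(\mathbb{H}^{n+1}\setminus\{0\})/\sim$, where $z\sim w$ iff $z=w\alpha$ for some $\alpha\in\mathbb{H}\setminus\{0\}$. $e_1,\dots,e_{n+1}$ denote the points of $\mathbb{P}^n_{\mathbb{H}}$ given by the standard basis vectors, and $L\{p_1,\dots,p_r\}$ is the smallest projective subspace (projectivization of an $\mathbb{H}$-linear subspace) containing the given points. Writing a quaternionic matrix as $A=A_1+A_2 j$ with $A_1,A_2$ complex, $\det_{\mathbb{H}}(A)=\det\begin{bmatrix}A_1&A_2\\-\overline{A_2}&\overline{A_1}\end{bmatrix}$; $\mathrm{SL}(n+1,\mathbb{H})=\{g:\det_{\mathbb{H}}(g)=1\}$, $\mathrm{PSL}(n+1,\mathbb{H})=\mathrm{SL}(n+1,\mathbb{H})/\{\pm I\}$, acting on $\mathbb{P}^n_{\mathbb{H}}$ via the linear action on $\mathbb{H}^{n+1}$. An element of $\mathrm{PSL}(n+1,\mathbb{H})$ is loxodromic if it is semisimple (its lifts are diagonalizable over $\mathbb{H}$) and not all its (right) eigenvalues have modulus $1$ (so here necessarily $p\ge2$). A family of maps from a topological space into $\mathbb{P}^n_{\mathbb{H}}$ is normal if every sequence in it has a subsequence converging uniformly on compact subsets. For a subgroup $G\le \mathrm{PSL}(n+1,\mathbb{H})$, $\mathrm{Eq}(G)$ is the set of $z\in\mathbb{P}^n_{\mathbb{H}}$ having an open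 neighborhood $U$ such that $\{g|_U: g\in G\}$ is normal. *)

(* Defs.v *)
From HB Require Import structures.
From mathcomp Require Import all_boot all_order all_algebra.
From mathcomp Require Import generic_quotient complex ring.
From mathcomp Require Import all_classical all_reals all_analysis.

Set Implicit Arguments.
Unset Strict Implicit.
Unset Printing Implicit Defensive.

Import Order.TTheory GRing.Theory Num.Theory.
Import numFieldNormedType.Exports.

Local Open Scope classical_set_scope.
Local Open Scope ring_scope.
Local Open Scope quotient_scope.

(* Quat a b c d stands for a + b i + c j + d k. *)
Record quat (R : Type) := Quat { qre : R; qi : R; qj : R; qk : R }.

Section QuaternionRing.
Variable R : realType.
Local Notation H := (quat R).
Implicit Types x y z : H.

Definition quat_tuple x := (qre x, qi x, qj x, qk x).
Definition tuple_quat (t : R * R * R * R) :=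
  Quat t.1.1.1 t.1.1.2 t.1.2 t.2.
Lemma quat_tupleK : cancel quat_tuple tuple_quat.
Proof. by case. Qed.
HB.instance Definition _ := Choice.copy H (can_type quat_tupleK).

Lemma quatP x y :
  [/\ qre x = qre y, qi x = qi y, qj x = qj y & qk x = qk y] -> x = y.
Proof. by case: x y => [? ? ? ?] [? ? ? ?] /= [-> -> -> ->]. Qed.

Definition addq x y :=
  Quat (qre x + qre y) (qi x + qi y) (qj x + qj y) (qk x + qk y).
Definition oppq x := Quat (- qre x) (- qi x) (- qj x) (- qk x).

Lemma addqA : associative addq.
Proof. by move=> x y z; apply: quatP; split; rewrite /= addrA. Qed.
Lemma addqC : commutative addq.
Proof. by move=> x y; apply: quatP; split; rewrite /= addrC. Qed.
Lemma add0q : left_id (Quat 0 0 0 0) addq.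
Proof. by move=> x; apply: quatP; split; rewrite /= add0r. Qed.
Lemma addNq : left_inverse (Quat 0 0 0 0) oppq addq.
Proof. by move=> x; apply: quatP; split; rewrite /= addNr. Qed.
HB.instance Definition _ := GRing.isZmodule.Build H addqA addqC add0q addNq.

Definition mulq x y := Quat
  (qre x * qre y - qi x * qi y - qj x * qj y - qk x * qk y)
  (qre x * qi y + qi x * qre y + qj x * qk y - qk x * qj y)
  (qre x * qj y - qi x * qk y + qj x * qre y + qk x * qi y)
  (qre x * qk y + qi x * qj y - qj x * qi y + qk x * qre y).

Lemma mulqA : associative mulq.
Proof. by move=> x y z; apply: quatP; split=> /=; ring. Qed.
Lemma mul1q : left_id (Quat 1 0 0 0) mulq.
Proof. by move=> x; apply: quatP; split=> /=; ring. Qed.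
Lemma mulq1 : right_id (Quat 1 0 0 0) mulq.
Proof. by move=> x; apply: quatP; split=> /=; ring. Qed.
Lemma mulqDl : left_distributive mulq +%R.
Proof. by move=> x y z; apply: quatP; split=> /=; ring. Qed.
Lemma mulqDr : right_distributive mulq +%R.
Proof. by move=> x y z; apply: quatP; split=> /=; ring. Qed.
Lemma oneq_neq0 : Quat 1 0 0 0 != 0 :> H.
Proof. by apply/eqP => -[/eqP]; rewrite oner_eq0. Qed.
HB.instance Definition _ :=
  GRing.Zmodule_isNzRing.Build H mulqA mul1q mulq1 mulqDl mulqDr oneq_neq0.

Definition scaleq (a : R) x := Quat (a * qre x) (a * qi x) (a * qj x) (a * qk x).
Lemma scaleqA a b x : scaleq a (scaleq b x) = scaleq (a * b) x.
Proof. by apply: quatP; split; rewrite /= mulrA. Qed.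
Lemma scale1q : left_id 1 scaleq.
Proof. by move=> x; apply: quatP; split; rewrite /= mul1r. Qed.
Lemma scaleqDr : right_distributive scaleq +%R.
Proof. by move=> a x y; apply: quatP; split; rewrite /= mulrDr. Qed.
Lemma scaleqDl x : {morph scaleq^~ x : a b / a + b}.
Proof. by move=> a b; apply: quatP; split; rewrite /= mulrDl. Qed.
HB.instance Definition _ :=
  GRing.Zmodule_isLmodule.Build R H scaleqA scale1q scaleqDr scaleqDl.
Lemma scaleqAl (a : R) x y : a *: (x * y) = a *: x * y.
Proof. by apply: quatP; split=> /=; ring. Qed.
Lemma scaleqAr (a : R) x y : a *: (x * y) = x * (a *: y).
Proof. by apply: quatP; split=> /=; ring. Qed.
HB.instance Definition _ := GRing.Lmodule_isLalgebra.Build R H scaleqAl.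
HB.instance Definition _ := GRing.Lalgebra_isAlgebra.Build R H scaleqAr.

Definition conjq x := Quat (qre x) (- qi x) (- qj x) (- qk x).
Definition normqsq x := qre x ^+ 2 + qi x ^+ 2 + qj x ^+ 2 + qk x ^+ 2.
Definition normq x := Num.sqrt (normqsq x).

Lemma normqsq_ge0 x : 0 <= normqsq x.
Proof. by rewrite !addr_ge0 ?sqr_ge0. Qed.

Lemma normqsq_eq0 x : normqsq x = 0 -> x = 0.
Proof.
move=> /eqP; rewrite !paddr_eq0 ?addr_ge0 ?sqr_ge0// !sqrf_eq0.
move=> /andP[/andP[/andP[/eqP ? /eqP ?] /eqP ?] /eqP ?].
by apply: quatP; split.
Qed.

Lemma sqr_normq x : normq x ^+ 2 = normqsq x.
Proof. by rewrite sqr_sqrtr// normqsq_ge0. Qed.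

Lemma normq_ge0 x : 0 <= normq x. Proof. exact: sqrtr_ge0. Qed.

Lemma normqsqM x y : normqsq (x * y) = normqsq x * normqsq y.
Proof. by rewrite /normqsq /=; ring. Qed.

Lemma normqM x y : normq (x * y) = normq x * normq y.
Proof. by rewrite /normq normqsqM sqrtrM// normqsq_ge0. Qed.

Lemma mulqJ x : x * conjq x = normqsq x *: 1.
Proof. by apply: quatP; rewrite /normqsq; split=> /=; ring. Qed.
Lemma mulJq x : conjq x * x = normqsq x *: 1.
Proof. by apply: quatP; rewrite /normqsq; split=> /=; ring. Qed.

Definition invq x := (normqsq x)^-1 *: conjq x.
Lemma normqsq_neq0 x : x != 0 -> normqsq x != 0.
Proof. by apply: contra_neq; exact: normqsq_eq0. Qed.
Lemma mulVq : {in [pred x | x != 0], left_inverse 1 invq *%R}.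
Proof.
by move=> x /normqsq_neq0 x0; rewrite /invq -scalerAl mulJq scalerA mulVf// scale1r.
Qed.
Lemma mulqV : {in [pred x | x != 0], right_inverse 1 invq *%R}.
Proof.
by move=> x /normqsq_neq0 x0; rewrite /invq -scalerAr mulqJ scalerA mulVf// scale1r.
Qed.
Lemma unitqP x y : y * x = 1 /\ x * y = 1 -> x != 0.
Proof.
move=> [yx _]; apply/eqP => x0.
by move: yx; rewrite x0 mulr0 => /esym/eqP; rewrite oner_eq0.
Qed.
Lemma invq_out : {in [predC [pred x | x != 0]], invq =1 id}.
Proof.
move=> x; rewrite !inE negbK => /eqP ->; rewrite /invq.
by apply: quatP; split; rewrite /= ?oppr0 mulr0.
Qed.
HB.instance Definition _ :=
  GRing.NzRing_hasMulInverse.Build H mulVq mulqV unitqP invq_out.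

Lemma ler_normqD x y : normq (x + y) <= normq x + normq y.
Proof.
rewrite -(@ler_pXn2r _ 2)// ?nnegrE ?addr_ge0 ?normq_ge0//.
rewrite sqrrD !sqr_normq.
pose s := qre x * qre y + qi x * qi y + qj x * qj y + qk x * qk y.
have -> : normqsq (x + y) = normqsq x + s *+ 2 + normqsq y.
  by rewrite /normqsq /s /=; ring.
rewrite lerD2r lerD2l lerMn2r /= (le_trans (ler_norm _))//.
rewrite -(@ler_pXn2r _ 2)// ?nnegrE ?mulr_ge0 ?normq_ge0//.
rewrite real_normK ?num_real// exprMn !sqr_normq -subr_ge0.
have -> : normqsq x * normqsq y - s ^+ 2 =
    (qre x * qi y - qi x * qre y) ^+ 2 + (qre x * qj y - qj x * qre y) ^+ 2 +
    (qre x * qk y - qk x * qre y) ^+ 2 + (qi x * qj y - qj x * qi y) ^+ 2 +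
    (qi x * qk y - qk x * qi y) ^+ 2 + (qj x * qk y - qk x * qj y) ^+ 2.
  by rewrite /normqsq /s; ring.
by rewrite !addr_ge0 ?sqr_ge0.
Qed.

Lemma normqZ (a : R) x : normq (a *: x) = `|a| * normq x.
Proof.
rewrite /normq -sqrtr_sqr -sqrtrM ?sqr_ge0//; congr Num.sqrt.
by rewrite /normqsq /=; ring.
Qed.

Lemma normq_eq0 x : normq x = 0 -> x = 0.
Proof. by move=> x0; apply: normqsq_eq0; rewrite -sqr_normq x0 expr0n. Qed.

HB.instance Definition _ := Lmodule_isNormed.Build R H ler_normqD normqZ normq_eq0.

Lemma norm_quatE x : `|x| = Num.sqrt (normqsq x). Proof. by []. Qed.
Lemma norm_quatM x y : `|x * y| = `|x| * `|y|. Proof. exact: normqM. Qed.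
Lemma norm_conjq x : `|conjq x| = `|x|.
Proof. by rewrite !norm_quatE /normqsq /= !sqrrN. Qed.
Lemma conjqB x y : conjq (x - y) = conjq x - conjq y.
Proof. by apply: quatP; split=> //=; rewrite opprD. Qed.
Lemma conjqM x y : conjq (x * y) = conjq y * conjq x.
Proof. by apply: quatP; split=> /=; ring. Qed.
Lemma quat_unitE x : (x \is a GRing.unit) = (x != 0). Proof. by []. Qed.

Lemma cvg_quatM (T : Type) (F : set_system T) {FF : Filter F} (f g : T -> H)
    (a b : H) :
  f @ F --> a -> g @ F --> b -> (fun t => f t * g t) @ F --> a * b.
Proof.
move=> fa gb; apply/subr_cvg0; apply/norm_cvg0P.
have fg t : f t * g t - a * b = (f t - a) * g t + a * (g t - b).
  by rewrite mulrBl mulrBr addrA subrK.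
apply: (@squeeze_cvgr _ _ _ _ (cst 0) (fun t => `|f t - a| * `|g t| + `|a| * `|g t - b|)).
- apply: nearW => t; rewrite /= normr_ge0/= fg (le_trans (ler_normD _ _))//.
  by rewrite !norm_quatM.
- exact: cvg_cst.
- have -> : (0 : R) = 0 * `|b| + `|a| * 0 by rewrite mul0r mulr0 addr0.
  apply: cvgD; apply: cvgM; [|exact: cvg_norm|exact: cvg_cst|].
    by apply/norm_cvg0P/subr_cvg0.
  by apply/norm_cvg0P/subr_cvg0.
Qed.

Lemma cvg_conjq (T : Type) (F : set_system T) {FF : Filter F} (f : T -> H)
    (a : H) :
  f @ F --> a -> (fun t => conjq (f t)) @ F --> conjq a.
Proof.
move=> /subr_cvg0/norm_cvg0P fa; apply/subr_cvg0/norm_cvg0P.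
by under eq_fun do rewrite -conjqB norm_conjq.
Qed.

End QuaternionRing.

Section SpecialLinear.
Variables (R : realType) (m : nat).
Local Notation H := (quat R).
Local Notation C := R[i].
Implicit Types A B : 'M[H]_m.

(* a + b i + c j + d k = (a + b i) + (c + d i) j. *)
Definition qc1 (x : H) : C := Complex (qre x) (qi x).
Definition qc2 (x : H) : C := Complex (qj x) (qk x).

Definition cplx_mx A : 'M[C]_(m + m) :=
  block_mx (map_mx qc1 A) (map_mx qc2 A)
           (- map_mx (fun x => conjc (qc2 x)) A)
           (map_mx (fun x => conjc (qc1 x)) A).

Definition detH A : C := \det (cplx_mx A).

Let cplxP (x y : C) : complex.Re x = complex.Re y -> complex.Im x = complex.Im y -> x = y.
Proof. by case: x y => ? ? [? ?] /= -> ->. Qed.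

Lemma qc1D (x y : H) : qc1 (x + y) = qc1 x + qc1 y. Proof. by []. Qed.
Lemma qc2D (x y : H) : qc2 (x + y) = qc2 x + qc2 y. Proof. by []. Qed.
Lemma qc1M (x y : H) : qc1 (x * y) = qc1 x * qc1 y - qc2 x * conjc (qc2 y).
Proof. by apply: cplxP => /=; ring. Qed.
Lemma qc2M (x y : H) : qc2 (x * y) = qc1 x * qc2 y + qc2 x * conjc (qc1 y).
Proof. by apply: cplxP => /=; ring. Qed.
Lemma qc1_sum I (r : seq I) (F : I -> H) :
  qc1 (\sum_(i <- r) F i) = \sum_(i <- r) qc1 (F i).
Proof. exact: (big_morph _ qc1D). Qed.
Lemma qc2_sum I (r : seq I) (F : I -> H) :
  qc2 (\sum_(i <- r) F i) = \sum_(i <- r) qc2 (F i).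
Proof. exact: (big_morph _ qc2D). Qed.

Lemma cplx_mx_inj : injective cplx_mx.
Proof.
move=> A B /eq_block_mx [e1 e2 _ _]; apply/matrixP => i j.
move/matrixP/(_ i j) : e1; move/matrixP/(_ i j) : e2; rewrite !mxE.
by move=> [e3 e4] [e1 e2]; apply: quatP.
Qed.

Lemma cplx_mx1 : cplx_mx 1%:M = 1%:M.
Proof.
rewrite [RHS]scalar_mx_block; congr block_mx; apply/matrixP => i j;
  rewrite !mxE; case: (i == j); apply: cplxP; rewrite /= ?oppr0//.
Qed.

Lemma cplx_mxN A : cplx_mx (- A) = - cplx_mx A.
Proof.
rewrite /cplx_mx opp_block_mx; congr block_mx; apply/matrixP => i j;
  rewrite !mxE; apply: cplxP; rewrite /= ?opprK//.
Qed.

Lemma cplx_mxM A B : cplx_mx (A *m B) = cplx_mx A *m cplx_mx B.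
Proof.
rewrite /cplx_mx mulmx_block; congr block_mx; apply/matrixP => i j;
  rewrite !mxE -?sumrN ?(qc1_sum, qc2_sum) ?rmorph_sum -?sumrN -?big_split/=;
  apply: eq_bigr => l _; rewrite !mxE; apply: cplxP => /=; ring.
Qed.

Lemma detHM A B : detH (A *m B) = detH A * detH B.
Proof. by rewrite /detH cplx_mxM det_mulmx. Qed.

Lemma detH1 : detH 1%:M = 1.
Proof. by rewrite /detH cplx_mx1 det1. Qed.

Lemma detHN A : detH (- A) = detH A.
Proof.
by rewrite /detH cplx_mxN -scaleN1r detZ exprD -exprMn mulrNN mulr1 expr1n mul1r.
Qed.

Definition invH A : 'M[H]_m :=
  let Y := invmx (cplx_mx A) in
  \matrix_(i, j) Quat
    (complex.Re (ulsubmx Y i j)) (complex.Im (ulsubmx Y i j))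
    (- complex.Re (dlsubmx Y i j)) (complex.Im (dlsubmx Y i j)).

Lemma mulmxVH A : detH A = 1 -> A *m invH A = 1%:M.
Proof.
move=> dA; pose Y := invmx (cplx_mx A).
have : cplx_mx A *m Y = 1%:M by rewrite mulmxV// unitmxE -/(detH A) dA unitr1.
rewrite -[Y]submxK /cplx_mx mulmx_block scalar_mx_block => /eq_block_mx[e1 _ e3 _].
apply/matrixP => i j; move/matrixP/(_ i j): e1; move/matrixP/(_ i j): e3.
set U := ulsubmx Y; set D := dlsubmx Y.
rewrite !mxE -!big_split/= => e3 e1.
have q1 : qc1 (\sum_l A i l * invH A l j) = \sum_l (qc1 (A i l) * U l j + qc2 (A i l) * D l j).
  rewrite qc1_sum; apply: eq_bigr => l _; rewrite qc1M mxE -/Y -/U -/D.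
  by apply: cplxP; case: (U l j) (D l j) => ? ? [? ?] /=; ring.
have q2 : qc2 (\sum_l A i l * invH A l j) =
    conjc (\sum_l (conjc (qc2 (A i l)) * U l j - conjc (qc1 (A i l)) * D l j)).
  rewrite qc2_sum rmorph_sum; apply: eq_bigr => l _; rewrite qc2M mxE -/Y -/U -/D.
  by apply: cplxP; case: (U l j) (D l j) => ? ? [? ?] /=; ring.
have {}q1 : qc1 (\sum_l A i l * invH A l j) = (i == j)%:R.
  by rewrite q1 -e1; apply: eq_bigr => l _; rewrite !mxE.
have {}q2 : qc2 (\sum_l A i l * invH A l j) = 0.
  rewrite q2 -[RHS](rmorph0 conjc) -[in RHS]oppr0 -[in RHS]e3 -sumrN; congr conjc.
  by apply: eq_bigr => l _; rewrite !mxE /=; ring.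
move: q1 q2; case: (i == j) => -[? ?] [? ?]; exact: quatP.
Qed.

Lemma detH_invH A : detH A = 1 -> detH (invH A) = 1.
Proof.
by move=> dA; rewrite -[LHS]mul1r -{1}dA -detHM mulmxVH// detH1.
Qed.

Lemma mulVmxH A : detH A = 1 -> invH A *m A = 1%:M.
Proof.
move=> dA; have AV := mulmxVH dA; have VA := mulmxVH (detH_invH dA).
rewrite -[RHS]VA; congr (_ *m _).
by rewrite -[LHS]mulmx1 -VA mulmxA AV mul1mx.
Qed.

Record SL := MkSL { slmx :> 'M[H]_m ; _ : detH slmx == 1 }.
HB.instance Definition _ := [isSub for slmx].
HB.instance Definition _ := [Choice of SL by <:].

Lemma detH_sl (g : SL) : detH g = 1. Proof. by case: g => A /= /eqP. Qed.

Lemma sl_mul_subproof (g h : SL) : detH (g *m h) == 1.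
Proof. by rewrite detHM !detH_sl mulr1. Qed.
Lemma sl_one_subproof : detH 1%:M == 1.
Proof. by rewrite detH1. Qed.
Lemma sl_inv_subproof (g : SL) : detH (invH g) == 1.
Proof. by rewrite detH_invH ?detH_sl. Qed.

Definition sl_mul g h := MkSL (sl_mul_subproof g h).
Definition sl_one := MkSL sl_one_subproof.
Definition sl_inv g := MkSL (sl_inv_subproof g).

Lemma sl_mulA : associative sl_mul.
Proof. by move=> f g h; apply: val_inj; rewrite /= mulmxA. Qed.
Lemma sl_mul1 : left_id sl_one sl_mul.
Proof. by move=> g; apply: val_inj; rewrite /= mul1mx. Qed.
Lemma sl_1mul : right_id sl_one sl_mul.
Proof. by move=> g; apply: val_inj; rewrite /= mulmx1. Qed.
Lemma sl_mulV : left_inverse sl_one sl_inv sl_mul.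
Proof. by move=> g; apply: val_inj; rewrite /= mulVmxH ?detH_sl. Qed.
Lemma sl_Vmul : right_inverse sl_one sl_inv sl_mul.
Proof. by move=> g; apply: val_inj; rewrite /= mulmxVH ?detH_sl. Qed.
HB.instance Definition _ :=
  isGroup.Build SL sl_mulA sl_mul1 sl_1mul sl_mulV sl_Vmul.

Definition psl_rel : rel SL :=
  fun g h => (slmx g == h) || (slmx g == - slmx h).

Lemma psl_rel_equiv : equiv_class_of psl_rel.
Proof.
split=> [g|g h|g h f]; rewrite /psl_rel.
- by rewrite eqxx.
- by rewrite eq_sym (eq_sym (slmx g) (- _)) eqr_oppLR.
- by move=> /orP[]/eqP-> /orP[]/eqP->; rewrite ?opprK eqxx ?orbT.
Qed.
Canonical psl_equiv := EquivRelPack psl_rel_equiv.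

Definition PSL := {eq_quot psl_rel}.
HB.instance Definition _ := Choice.on PSL.
HB.instance Definition _ := EqQuotient.on PSL.

Lemma pslP (g h : SL) : (\pi_PSL g = \pi_PSL h) <-> psl_rel g h.
Proof. by split=> [/eqmodP|] // gh; apply/eqmodP. Qed.

Lemma psl_reprP (g : SL) : psl_rel (repr (\pi_PSL g)) g.
Proof. by apply/pslP; rewrite reprK. Qed.

Definition psl_mul (x y : PSL) : PSL := \pi_PSL (repr x * repr y)%g.
Definition psl_inv (x : PSL) : PSL := \pi_PSL ((repr x)^-1)%g.
Definition psl_one : PSL := \pi_PSL 1%g.

Lemma psl_relM (g g' h h' : SL) :
  psl_rel g g' -> psl_rel h h' -> psl_rel (g * h)%g (g' * h')%g.
Proof.
rewrite /psl_rel /= => /orP[]/eqP-> /orP[]/eqP->;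
by rewrite ?mulmxN ?mulNmx ?opprK eqxx ?orbT.
Qed.

Lemma psl_relV (g g' : SL) : psl_rel g g' -> psl_rel (g^-1)%g (g'^-1)%g.
Proof.
move=> gg'; have rxx (h : SL) : psl_rel h h by rewrite /psl_rel eqxx.
have := psl_relM (psl_relM (rxx (g^-1)%g) gg') (rxx (g'^-1)%g).
rewrite (mulVg g) mul1g -mulgA mulgV mulg1 => /orP[]/eqP e; rewrite /psl_rel e ?opprK eqxx ?orbT//.
Qed.

Lemma pi_pslM (g h : SL) : \pi_PSL (g * h)%g = psl_mul (\pi_PSL g) (\pi_PSL h).
Proof. by apply/esym/pslP; apply: psl_relM; exact: psl_reprP. Qed.
Lemma pi_pslV (g : SL) : \pi_PSL (g^-1)%g = psl_inv (\pi_PSL g).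
Proof. by apply/esym/pslP; apply: psl_relV; exact: psl_reprP. Qed.

Lemma psl_mulA : associative psl_mul.
Proof.
move=> x y z; elim/quotW: x => f; elim/quotW: y => g; elim/quotW: z => h.
by rewrite -(pi_pslM g h) -(pi_pslM f g) -(pi_pslM f) -(pi_pslM _ h) mulgA.
Qed.
Lemma psl_mul1 : left_id psl_one psl_mul.
Proof. by move=> x; elim/quotW: x => g; rewrite -(pi_pslM 1%g g) mul1g. Qed.
Lemma psl_1mul : right_id psl_one psl_mul.
Proof. by move=> x; elim/quotW: x => g; rewrite -(pi_pslM g 1%g) mulg1. Qed.
Lemma psl_mulV : left_inverse psl_one psl_inv psl_mul.
Proof. by move=> x; elim/quotW: x => g; rewrite -(pi_pslV g) -(pi_pslM (g^-1)%g g) mulVg. Qed.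
Lemma psl_Vmul : right_inverse psl_one psl_inv psl_mul.
Proof. by move=> x; elim/quotW: x => g; rewrite -(pi_pslV g) -(pi_pslM g (g^-1)%g) mulgV. Qed.
HB.instance Definition _ :=
  isGroup.Build PSL psl_mulA psl_mul1 psl_1mul psl_mulV psl_Vmul.

(* v *m a%:M is the right multiple v a of the column v. *)
Definition right_eigenvalue A (a : H) :=
  exists2 v : 'cV[H]_m, v != 0 & A *m v = v *m a%:M.

Definition diagonalizableH A :=
  exists S T : 'M[H]_m,
    [/\ S *m T = 1%:M, T *m S = 1%:M & is_diag_mx (T *m A *m S)].

Definition loxodromic (x : PSL) := forall g : SL, \pi_PSL g = x ->
  diagonalizableH g /\ ~ (forall a, right_eigenvalue g a -> `|a| = 1).

End SpecialLinear.

Section ProjectiveSpace.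
Variables (R : realType) (n : nat).
Local Notation H := (quat R).
Local Notation V := ('cV[quat R]_n.+1).

Definition nzvec : Type := {z : V | z != 0}.
HB.instance Definition _ := [isSub of nzvec for @sval V (fun z => z != 0)].
HB.instance Definition _ := [Choice of nzvec by <:].
HB.instance Definition _ :=
  Topological.copy nzvec (initial_topology (\val : nzvec -> V)).

Definition proj_rel : rel nzvec :=
  fun z w => `[< exists2 a : H, a != 0 & \val z = \val w *m a%:M >].

Lemma proj_rel_equiv : equiv_class_of proj_rel.
Proof.
have sym z w : proj_rel z w -> proj_rel w z.
  move=> /asboolP[a a0 zw]; apply/asboolP; exists a^-1; first by rewrite invr_neq0.
  by rewrite zw -mulmxA -scalar_mxM mulrV ?mulmx1.
split=> [z|z w|w z t].
- by apply/asboolP; exists 1; rewrite ?oner_eq0 ?mulmx1.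
- by apply/idP/idP; exact: sym.
- move=> /asboolP[a a0 zw] /asboolP[b b0 wt]; apply/asboolP; exists (b * a).
    by rewrite -quat_unitE unitrMl ?quat_unitE.
  by rewrite zw wt -mulmxA -scalar_mxM.
Qed.
Canonical proj_equiv := EquivRelPack proj_rel_equiv.

(* P^n_H, with n + 1 homogeneous coordinates. *)
Definition PH : Type := quotient_topology {eq_quot proj_rel}.
HB.instance Definition _ := Topological.on PH.
HB.instance Definition _ := Quotient.on PH.

Lemma PHP (z w : nzvec) : (\pi_PH z = \pi_PH w) <-> proj_rel z w.
Proof. by split=> [/eqmodP|zw] //; apply/eqmodP. Qed.

(* The matrix of the orthogonal projection onto the line spanned by z. *)
Definition vnsq (z : V) : R := \sum_i normqsq (z i 0).
Definition line_mx (z : V) : 'M[H]_n.+1 :=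
  \matrix_(i, j) ((vnsq z)^-1 *: (z i 0 * conjq (z j 0))).

Lemma vnsq_neq0 (z : V) : z != 0 -> vnsq z != 0.
Proof.
apply: contra_neq => /eqP; rewrite psumr_eq0 => [|i _]; last exact: normqsq_ge0.
move=> /allP z0; apply/matrixP => i j; rewrite ord1 mxE; apply: normqsq_eq0.
by apply/eqP/z0; rewrite mem_index_enum.
Qed.

Lemma mx11M (z : V) (a : H) i : (z *m a%:M) i 0 = z i 0 * a.
Proof. by rewrite mxE big_ord1 !mxE eqxx mulr1n. Qed.

Lemma line_mxM (z : V) (a : H) : a != 0 -> line_mx (z *m a%:M) = line_mx z.
Proof.
move=> a0; have na := normqsq_neq0 a0.
have nz : vnsq (z *m a%:M) = vnsq z * normqsq a.
  by rewrite /vnsq mulr_suml; apply: eq_bigr => i _; rewrite mx11M normqsqM.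
apply/matrixP => i j; rewrite !mxE nz -/(z *m a%:M) !big_ord1 !mxE eqxx !mulr1n.
rewrite conjqM -mulrA (mulrA a) mulqJ -scalerAl mul1r -scalerAr scalerA invfM.
by rewrite -mulrA mulVf// mulr1.
Qed.

Lemma line_mxE (u z : V) :
  line_mx u *m z = u *m ((vnsq u)^-1 *: \sum_j conjq (u j 0) * z j 0)%:M.
Proof.
apply/matrixP => i j; rewrite ord1 mx11M mxE -scalerAr mulr_sumr scaler_sumr.
by apply: eq_bigr => l _; rewrite mxE -scalerAl mulrA.
Qed.

Lemma line_mx_id (z : V) : z != 0 -> line_mx z *m z = z.
Proof.
move=> z0; rewrite line_mxE.
have -> : \sum_j conjq (z j 0) * z j 0 = vnsq z *: 1.
  by rewrite scaler_suml; apply: eq_bigr => j _; rewrite mulJq.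
by rewrite scalerA mulVf ?vnsq_neq0// scale1r mulmx1.
Qed.

Definition ph_mx (p : PH) : 'M[H]_n.+1 := line_mx (\val (repr p)).

Lemma ph_mx_pi (z : nzvec) : ph_mx (\pi_PH z) = line_mx (\val z).
Proof.
rewrite /ph_mx; have /PHP/asboolP[a a0 ->] : \pi_PH (repr (\pi_PH z)) = \pi_PH z.
  by rewrite reprK.
exact: line_mxM.
Qed.

Lemma pi_line_mx (q : PH) (z w : nzvec) :
  \val w = ph_mx q *m \val z -> \pi_PH w = q.
Proof.
move=> wz; rewrite -[q]reprK; apply/PHP/asboolP.
rewrite wz /ph_mx line_mxE; set a := _ *: _; exists a => //.
apply: contra_neq (valP w) => a0.
by rewrite wz /ph_mx line_mxE -/a a0 raddf0 mulmx0.
Qed.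

Definition chordal_dist (p q : PH) : R :=
  \sum_i \sum_j `|ph_mx p i j - ph_mx q i j|.

Lemma chordal_distxx p : chordal_dist p p = 0.
Proof. by rewrite /chordal_dist big1// => i _; rewrite big1// => j _; rewrite subrr normr0. Qed.

Lemma chordal_dist_ge0 p q : 0 <= chordal_dist p q.
Proof. by rewrite sumr_ge0// => i _; rewrite sumr_ge0. Qed.

Lemma chordal_dist_sym p q : chordal_dist p q = chordal_dist q p.
Proof. by apply: eq_bigr => i _; apply: eq_bigr => j _; rewrite distrC. Qed.

Lemma chordal_dist_triangle q p r :
  chordal_dist p r <= chordal_dist p q + chordal_dist q r.
Proof.
rewrite -big_split/= ler_sum// => i _; rewrite -big_split/= ler_sum// => j _.
by rewrite (le_trans _ (ler_normD _ _))// addrA subrK.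
Qed.

Lemma chordal_dist_positivity p q : chordal_dist p q = 0 -> p = q.
Proof.
move=> /eqP; rewrite psumr_eq0 => [/allP pq|i _]; last by rewrite sumr_ge0.
have {}pq : ph_mx p = ph_mx q.
  apply/matrixP => i j; apply/eqP; rewrite -subr_eq0 -normr_eq0.
  have := pq i (mem_index_enum _); rewrite /= psumr_eq0 // => /allP.
  by apply; rewrite mem_index_enum.
rewrite -[LHS]reprK; apply: (@pi_line_mx _ (repr p)).
by rewrite -pq /ph_mx line_mx_id// (valP (repr p)).
Qed.

Lemma val_coord_continuous i (z0 : nzvec) :
  (fun z : nzvec => (\val z : V) i 0) @ z0 --> (\val z0 : V) i 0.
Proof.
apply: (@cvg_comp _ _ _ (\val : nzvec -> V) (fun z : V => z i 0) _
  (nbhs (\val z0 : V))).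
  exact: (@initial_continuous nzvec V \val z0).
move=> A nA; exists (fun i' j => if i' == i then A else setT).
  by move=> i' j; case: eqP => [->|_]; rewrite ?(ord1 j)//; exact: filterT.
by move=> w /= /(_ i 0); rewrite eqxx.
Qed.

Lemma chordal_dist_pi_continuous p :
  continuous (fun z : nzvec => chordal_dist p (\pi_PH z)).
Proof.
move=> z0; rewrite /continuous_at /chordal_dist.
have := fun i => @val_coord_continuous i z0.
move: (nbhs z0) (@nbhs_filter nzvec z0) => F FF Fz.
apply: cvg_big => [|i _]; first exact: add_continuous.
apply: cvg_big => [|j _]; first exact: add_continuous.
apply: cvg_norm; apply: cvgB; first exact: cvg_cst.
have -> : (fun z : nzvec => ph_mx (\pi_PH z) i j) =
    (fun z => (vnsq (\val z))^-1 *: ((\val z : V) i 0 * conjq ((\val z : V) j 0))).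
  by apply/funext => z; rewrite ph_mx_pi mxE.
rewrite ph_mx_pi mxE; apply: cvgZ.
  apply: cvgV; first by rewrite vnsq_neq0// (valP z0).
  apply: cvg_big => [|l _]; first exact: add_continuous.
  have -> : (fun z : nzvec => normqsq ((\val z : V) l 0)) =
      (fun z => `|(\val z : V) l 0| * `|(\val z : V) l 0|).
    by apply/funext => z; rewrite -expr2 sqr_normq.
  rewrite -sqr_normq expr2.
  by apply: cvgM; apply: cvg_norm; exact: Fz.
apply: cvg_quatM; first exact: Fz.
by apply: cvg_conjq; exact: Fz.
Qed.

Definition chordal_ball (p : PH) (e : R) : set PH := [set q | chordal_dist p q < e].

Lemma nbhs_chordal_ball (p : PH) (A : set PH) :
  nbhs p A <-> exists2 e : R, 0 < e & chordal_ball p e `<=` A.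
Proof.
split.
  rewrite nbhsE => -[B [oB Bp] BA].
  have [C oC CB] : open (\pi_PH @^-1` B : set nzvec) by exact: oB.
  pose z := repr p.
  have Cz : C (\val z).
    have : (\pi_PH @^-1` B) z by rewrite /= reprK.
    by rewrite -CB.
  have /nbhs_ballP[d /= d0 dC] := open_nbhs_nbhs (conj oC Cz).
  have [i0 zi0] : exists i, (\val z : V) i 0 != 0.
    apply/existsP; apply: contraT; rewrite negb_exists => /forallP z0.
    move/negP: (valP z); case; apply/eqP.
    by apply/matrixP => i j; rewrite ord1 mxE; apply/eqP; have := z0 i; rewrite negbK.
  pose M := 1 + \sum_j `|(\val z : V) j 0|.
  have M0 : 0 < M by rewrite ltr_pwDl// sumr_ge0.
  pose e := Num.min d `|(\val z : V) i0 0| / M.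
  exists e; first by rewrite divr_gt0// lt_min d0 normr_gt0.
  move=> q pq; apply: BA.
  pose w : V := ph_mx q *m \val z.
  have wz i : `|(\val z : V) i 0 - w i 0| < Num.min d `|(\val z : V) i0 0|.
    have -> : (\val z : V) i 0 = (ph_mx p *m \val z) i 0.
      by rewrite /ph_mx line_mx_id// (valP z).
    rewrite !mxE -sumrB (le_lt_trans (ler_norm_sum _ _ _))//.
    apply: (@le_lt_trans _ _ (chordal_dist p q * M)); last by rewrite -ltr_pdivlMr.
    apply: (@le_trans _ _ (\sum_j `|ph_mx p i j - ph_mx q i j| * M)).
      apply: ler_sum => j _; rewrite -mulrBl norm_quatM ler_wpM2l//.
      by rewrite /M (bigD1 j)//= addrCA lerDl addr_ge0// sumr_ge0.
    rewrite -mulr_suml; apply: ler_wpM2r; first exact: ltW.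
    rewrite /chordal_dist [leRHS](bigD1 i)//= lerDl.
    by rewrite sumr_ge0// => ? _; rewrite sumr_ge0.
  have w0 : w != 0.
    apply/eqP => w0; have := wz i0.
    by rewrite w0 mxE subr0 lt_min ltxx andbF.
  have -> : q = \pi_PH (Sub w w0 : nzvec).
    exact/esym/(@pi_line_mx _ z).
  suff : (\pi_PH @^-1` B) (Sub w w0 : nzvec) by [].
  rewrite -CB /=; apply: dC; split=> // i j; rewrite !ord1.
  by have := wz i; rewrite lt_min => /andP[].
move=> [e e0 eA]; rewrite nbhsE; exists (chordal_ball p e) => //; split.
  have -> : open (chordal_ball p e) = open (\pi_PH @^-1` chordal_ball p e : set nzvec) by [].
  have /continuousP/(_ _ (@open_lt R e)) := @chordal_dist_pi_continuous p.
  exact.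
by rewrite /chordal_ball /= chordal_distxx.
Qed.

Let ph_ball_center p (e : R) : 0 < e -> chordal_ball p e p.
Proof. by move=> e0; rewrite /chordal_ball/= chordal_distxx. Qed.
Let ph_ball_sym p q (e : R) : chordal_ball p e q -> chordal_ball q e p.
Proof. by rewrite /chordal_ball/= chordal_dist_sym. Qed.
Let ph_ball_triangle p q r (e1 e2 : R) :
  chordal_ball p e1 q -> chordal_ball q e2 r -> chordal_ball p (e1 + e2) r.
Proof.
by rewrite /chordal_ball/= => ? ?; rewrite (le_lt_trans (chordal_dist_triangle q _ _))// ltrD.
Qed.
Let ph_nbhsE : nbhs = nbhs_ (entourage_ chordal_ball).
Proof.
apply/funext => p; apply/funext => A; apply/propext; rewrite nbhs_chordal_ball; split.
  move=> [e e0 eA]; exists [set xy | chordal_ball xy.1 e xy.2]; first by exists e.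
  by move=> q /xsectionP; exact: eA.
move=> [B [e e0 eB] BA]; exists e => // q pq; apply: BA; apply/xsectionP.
exact: eB.
Qed.

(* The metric induces the quotient topology (nbhs_chordal_ball); as P^n_H is
   compact, uniform convergence does not depend on the choice of such a
   metric. *)
HB.instance Definition _ := @Nbhs_isPseudoMetric.Build R PH
  (entourage_ chordal_ball) ph_nbhsE chordal_ball
  ph_ball_center ph_ball_sym ph_ball_triangle erefl.
HB.instance Definition _ := @Uniform_isPseudoMetric.Build R PH chordal_ball
  ph_ball_center ph_ball_sym ph_ball_triangle erefl.
HB.instance Definition _ := @PseudoMetric_isMetric.Build R PH
  chordal_dist chordal_dist_ge0 chordal_dist_positivity (fun _ _ => erefl).

End ProjectiveSpace.

Section Equicontinuity.
Variables (R : realType) (n : nat).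
Local Notation H := (quat R).
Local Notation V := ('cV[quat R]_n.+1).
Local Notation P := (PH R n).
Local Notation G := (PSL R n.+1).

Lemma sl_act_subproof (g : SL R n.+1) (z : nzvec R n) : slmx g *m \val z != 0.
Proof.
apply: contra_neq (valP z) => gz0.
by rewrite -[LHS]mul1mx -(mulVmxH (detH_sl g)) -mulmxA gz0 mulmx0.
Qed.

Definition sl_act (g : SL R n.+1) (z : nzvec R n) : nzvec R n :=
  Sub (slmx g *m \val z) (sl_act_subproof g z).

Definition psl_act (x : G) (p : P) : P := \pi_P (sl_act (repr x) (repr p)).

Lemma psl_act_pi (g : SL R n.+1) (z : nzvec R n) :
  psl_act (\pi_G g) (\pi_P z) = \pi_P (sl_act g z).
Proof.
have [a a0 za] : exists2 a : H, a != 0 & \val (repr (\pi_P z)) = \val z *m a%:M.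
  by apply/asboolP/PHP; rewrite reprK.
apply/PHP/asboolP => /=.
have /orP[/eqP->|/eqP->] := psl_reprP g; first by exists a; rewrite // za mulmxA.
exists (- a); rewrite ?oppr_eq0// za raddfN/= mulmxN mulNmx mulmxA.
by [].
Qed.

Definition right_subspace (W : set V) :=
  [/\ W 0, (forall u v, W u -> W v -> W (u + v)) &
      (forall v (a : H), W v -> W (v *m a%:M))].

Definition projective_subspace (L : set P) :=
  exists2 W : set V, right_subspace W &
    L = [set \pi_P z | z in [set z : nzvec R n | W (\val z)]].

Definition lspan (S : set P) : set P := smallest projective_subspace S.

Lemma std_vec_neq0 (i : 'I_n.+1) : delta_mx i 0 != 0 :> V.
Proof.
by apply/eqP => /matrixP/(_ i 0)/eqP; rewrite !mxE !eqxx oner_eq0.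
Qed.
Definition std_point (i : 'I_n.+1) : P :=
  \pi_P (Sub (delta_mx i 0) (std_vec_neq0 i) : nzvec R n).

Definition normal_family (X : topologicalType) (F : set (X -> P)) :=
  forall f : nat -> X -> P, (forall m, F (f m)) ->
  exists2 s : nat -> nat, {homo s : a b / (a < b)%N} &
  exists h : X -> P, {family compact, (fun m => f (s m)) @ \oo --> h}.

(* sigL U f is the restriction of f to the subspace (set_type) U. *)
Definition Eq_region (S : set G) : set P :=
  [set z | exists U : set P, [/\ open U, U z &
    normal_family [set sigL U (psl_act x) | x in S]]].

Definition cyclic_group (x : G) : set G :=
  [set y | exists m : nat, y = (x ^+ m)%g \/ y = (x ^- m)%g].

Definition modulus_block (r : R) k (D : 'M[H]_k) :=
  is_diag_mx D /\ forall j, `|D j j| = r.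

End Equicontinuity.

(* Main.v *)
(* The lift acts on homogeneous coordinates by a diagonal matrix, so up to a real
   scalar every element of the group is [diag t] with all [|t_i| <= 1] and one
   coordinate of modulus 1, in the last block (nonnegative powers) or in the first
   one (negative powers).  Near a point having nonzero coordinates in both extreme
   blocks, a convergent subsequence of such [t], with limit [u], acts uniformly
   closely to [diag u], which is well defined there.  At a point z whose
   coordinates in the last block vanish, the points z + e e_i with e <> 0 and i in
   the last block are all attracted to e_i by the powers of the lift, whereas the
   orbit of z stays in the hyperplane z_i = 0: no limit of powers can be locally
   uniform.  The first block is handled in the same way with the inverse. *)
Require Import Defs.
From mathcomp Require Import all_boot all_order all_algebra.
From mathcomp Require Import generic_quotient.
From mathcomp Require Import all_classical all_reals all_analysis.
From mathcomp Require Import ring lra.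

Set Implicit Arguments.
Unset Strict Implicit.
Unset Printing Implicit Defensive.

Import Order.TTheory GRing.Theory Num.Theory.
Import numFieldNormedType.Exports.

Local Open Scope classical_set_scope.
Local Open Scope ring_scope.
Local Open Scope quotient_scope.

(** * Diagonal maps of projective space, estimated in the chordal distance *)

Section ProjectiveScaling.
Variables (R : realType) (n : nat).
Local Notation H := (quat R).
Local Notation V := ('cV[quat R]_n.+1).
Local Notation P := (PH R n).
Local Notation G := (PSL R n.+1).
Implicit Types (t u : 'rV[H]_n.+1) (v x y : V) (z : nzvec R n).

Lemma vnsqE v : vnsq v = \sum_i `|v i 0| ^+ 2.
Proof. by apply: eq_bigr => i _; rewrite sqr_normq. Qed.

Lemma vnsq_ge0 v : 0 <= vnsq v.
Proof. by rewrite sumr_ge0// => i _; rewrite normqsq_ge0. Qed.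

Lemma vnsq_gt0 v : v != 0 -> 0 < vnsq v.
Proof. by move=> v0; rewrite lt_neqAle eq_sym vnsq_neq0// vnsq_ge0. Qed.

Lemma coord_le_vnsq v i : `|v i 0| ^+ 2 <= vnsq v.
Proof. by rewrite vnsqE (bigD1 i)//= lerDl sumr_ge0. Qed.

Lemma coordM_le_vnsq v i j : `|v i 0| * `|v j 0| <= vnsq v.
Proof.
rewrite -(@ler_pXn2r _ 2)// ?nnegrE ?mulr_ge0 ?vnsq_ge0//.
by rewrite exprMn expr2 ler_pM ?coord_le_vnsq ?exprn_ge0.
Qed.

(** This is the squared modulus of the normalised [i]-th coordinate: a function on projective space
    that vanishes exactly on the hyperplane z_i = 0 and serves as the measure of distance to it. *)
Lemma norm_ph_mx_diag z i :
  `|ph_mx (\pi_P z) i i| = `|(\val z : V) i 0| ^+ 2 / vnsq (\val z).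
Proof.
rewrite ph_mx_pi mxE normrZ norm_quatM norm_conjq ger0_norm ?invr_ge0 ?vnsq_ge0//.
by rewrite mulrC expr2.
Qed.

Lemma norm_ph_mx_dist (p q : P) i j :
  `| `|ph_mx p i j| - `|ph_mx q i j| | <= chordal_dist p q.
Proof.
apply: (le_trans (ler_dist_dist _ _)).
rewrite /chordal_dist (bigD1 i)//= (bigD1 j)//= -addrA lerDl addr_ge0 ?sumr_ge0//.
by move=> *; rewrite sumr_ge0.
Qed.

Lemma diag_mx_coord t v i : (diag_mx t *m v) i 0 = t 0 i * v i 0.
Proof. by rewrite mul_diag_mx mxE. Qed.

(* The entries differ by
   [(x_i x_j^* - y_i y_j^* ) / |x|^2 + (|y|^2 - |x|^2) y_i y_j^* / (|x|^2 |y|^2)]. *)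
Lemma line_mx_dist x y v (e d : R) i j : 0 < d -> v != 0 ->
  (forall l, `|x l 0| <= `|v l 0|) -> (forall l, `|y l 0| <= `|v l 0|) ->
  0 <= e -> (forall l, `|x l 0 - y l 0| <= e * `|v l 0|) ->
  d * vnsq v <= vnsq x -> d * vnsq v <= vnsq y ->
  `|line_mx x i j - line_mx y i j| <= 4 * e / d.
Proof.
move=> d0 v0 xv yv e0 xy dx dy.
have W0 := vnsq_gt0 v0; set W := vnsq v in dx dy W0 *.
have dW : 0 < d * W by rewrite mulr_gt0.
have X0 : 0 < vnsq x by exact: lt_le_trans dx.
have Y0 : 0 < vnsq y by exact: lt_le_trans dy.
have XY : `|vnsq y - vnsq x| <= 2 * e * W.
  rewrite !vnsqE -sumrB (le_trans (ler_norm_sum _ _ _))//.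
  rewrite /W vnsqE mulr_sumr ler_sum// => l _.
  (* The difference factor is at most [e] times [|v l 0|], the sum factor at most twice
     [|v l 0|]. *)
  rewrite subr_sqr normrM.
  have -> : 2 * e * `|v l 0| ^+ 2 = (e * `|v l 0|) * (`|v l 0| + `|v l 0|) by ring.
  rewrite ler_pM// ?(le_trans (ler_dist_dist _ _)) 1?distrC//.
  by rewrite ger0_norm ?addr_ge0// lerD.
have -> : line_mx x i j - line_mx y i j =
  (vnsq x)^-1 *: (x i 0 * conjq (x j 0) - y i 0 * conjq (y j 0)) +
  ((vnsq y - vnsq x) / (vnsq x * vnsq y)) *: (y i 0 * conjq (y j 0)).
  rewrite !mxE scalerBr -addrA; congr (_ + _); rewrite -!scaleNr -scalerDl.
  by congr (_ *: _); field; rewrite !gt_eqF.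
(* Each of the two terms of the decomposition accounts for half of the bound. *)
have -> : 4 * e / d = 2 * e / d + 2 * e / d by field; rewrite gt_eqF.
apply: (le_trans (ler_normD _ _)); apply: lerD; rewrite normrZ.
- rewrite gtr0_norm ?invr_gt0// ler_pdivrMl//.
  apply: (@le_trans _ _ (2 * e * W)); last first.
    have -> : vnsq x * (2 * e / d) = 2 * e * (d^-1 * vnsq x) by ring.
    by rewrite ler_wpM2l ?mulr_ge0// ler_pdivlMl.
  have -> : x i 0 * conjq (x j 0) - y i 0 * conjq (y j 0) =
    (x i 0 - y i 0) * conjq (x j 0) + y i 0 * conjq (x j 0 - y j 0).
    by rewrite conjqB mulrBl mulrBr addrA subrK.
  apply: (le_trans (ler_normD _ _)); rewrite !norm_quatM !norm_conjq.
  apply: (@le_trans _ _ (2 * e * (`|v i 0| * `|v j 0|))); last first.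
    by rewrite ler_wpM2l ?mulr_ge0// coordM_le_vnsq.
  have -> : 2 * e * (`|v i 0| * `|v j 0|) =
    (e * `|v i 0|) * `|v j 0| + `|v i 0| * (e * `|v j 0|) by ring.
  by rewrite lerD// ler_pM.
- rewrite normrM norm_quatM norm_conjq.
  apply: (@le_trans _ _ (2 * e * W / (vnsq x * vnsq y) * vnsq y)).
    rewrite ler_pM ?mulr_ge0 ?coordM_le_vnsq//.
    by rewrite normfV (gtr0_norm (mulr_gt0 X0 Y0)) ler_wpM2r// invr_ge0 mulr_ge0// ltW.
  have -> : 2 * e * W / (vnsq x * vnsq y) * vnsq y = 2 * e * (W / vnsq x).
    by field; rewrite !gt_eqF.
  by rewrite ler_wpM2l ?mulr_ge0// ler_pdivrMr// ler_pdivlMl.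
Qed.

Lemma line_mx_diag_dist t u v (e d : R) i j : 0 < d -> v != 0 ->
  (forall l, `|t 0 l| <= 1) -> (forall l, `|u 0 l| <= 1) ->
  (forall l, `|t 0 l - u 0 l| <= e) ->
  d * vnsq v <= vnsq (diag_mx t *m v) -> d * vnsq v <= vnsq (diag_mx u *m v) ->
  `|line_mx (diag_mx t *m v) i j - line_mx (diag_mx u *m v) i j| <= 4 * e / d.
Proof.
move=> d0 v0 t1 u1 tu; apply: line_mx_dist => // [l|l||l].
- by rewrite diag_mx_coord norm_quatM ler_piMl.
- by rewrite diag_mx_coord norm_quatM ler_piMl.
- exact: le_trans (tu i).
- by rewrite !diag_mx_coord -mulrBl norm_quatM ler_wpM2r.
Qed.

(* Where [diag_mx t] kills the representative of [q] the value is the junk [q]. *)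
Definition proj_scale t (q : P) : P :=
  \pi_P (insubd (repr q) (diag_mx t *m \val (repr q))).

(** Matrices act from the left and homogeneous coordinates are defined up to right multiples, so the
    two operations commute and the representative does not matter. *)
Lemma proj_scale_pi t z (tz : diag_mx t *m \val z != 0) :
  proj_scale t (\pi_P z) = \pi_P (Sub (diag_mx t *m \val z) tz : nzvec R n).
Proof.
have /PHP/asboolP[a a0 za] : \pi_P (repr (\pi_P z)) = \pi_P z by rewrite reprK.
have tza : diag_mx t *m \val (repr (\pi_P z)) != 0.
  rewrite za mulmxA; apply: contra_neq tz => /(congr1 (mulmx^~ (a^-1)%:M)) /=.
  by rewrite -[X in X = _](mulmxA _ a%:M) -scalar_mxM mulrV ?mulmx1 ?mul0mx.
apply/PHP/asboolP; exists a => //.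
by rewrite val_insubd tza /= za mulmxA.
Qed.

Lemma ph_mx_proj_scale t z : diag_mx t *m \val z != 0 ->
  ph_mx (proj_scale t (\pi_P z)) = line_mx (diag_mx t *m \val z).
Proof. by move=> tz; rewrite (proj_scale_pi tz) ph_mx_pi. Qed.

(** A real factor is central in the quaternions, so it can be moved to the right of the coordinates,
    where the projective class absorbs it. *)
Lemma psl_act_diag (g : SL R n.+1) t (a : R) (q : P) : a != 0 ->
  slmx g = diag_mx (\row_i (a *: t 0 i)) -> psl_act (\pi_G g) q = proj_scale t q.
Proof.
move=> a0 gt; rewrite -[q]reprK psl_act_pi.
set z := repr q.
have gz : slmx g *m \val z = (diag_mx t *m \val z) *m (a *: 1)%:M.
  apply/matrixP => i j; rewrite gt ord1 mx11M !diag_mx_coord mxE.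
  by rewrite -scalerAl -scalerAr mulr1.
have tz : diag_mx t *m \val z != 0.
  by apply: contra_neq (valP (sl_act g z)) => tz; rewrite /= gz tz mul0mx.
rewrite (proj_scale_pi tz); apply/PHP/asboolP; exists (a *: 1) => //.
by rewrite scaler_eq0 negb_or a0 oner_eq0.
Qed.

Lemma chordal_dist_proj_scale t u (e d : R) (q : P) : 0 < d ->
  (forall i, `|t 0 i| <= 1) -> (forall i, `|u 0 i| <= 1) ->
  (forall i, `|t 0 i - u 0 i| <= e) ->
  d * vnsq (\val (repr q)) <= vnsq (diag_mx t *m \val (repr q)) ->
  d * vnsq (\val (repr q)) <= vnsq (diag_mx u *m \val (repr q)) ->
  chordal_dist (proj_scale t q) (proj_scale u q) <= (4 * e / d) *+ n.+1 *+ n.+1.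
Proof.
move=> d0 t1 u1 tu dt du; set v := \val (repr q) in dt du.
have v0 : v != 0 := valP (repr q).
(* The lower bound on the norm keeps [proj_scale] away from its default value. *)
have nz s : d * vnsq v <= vnsq (diag_mx s *m v) -> diag_mx s *m v != 0.
  apply: contraTneq => ->; rewrite -ltNge /vnsq big1 => [|i _]; last first.
    by rewrite mxE /normqsq /= expr0n !addr0.
  by rewrite mulr_gt0 ?vnsq_gt0.
have -> : 4 * e / d *+ n.+1 *+ n.+1 = \sum_(i < n.+1) \sum_(j < n.+1) (4 * e / d).
  by rewrite !sumr_const !card_ord.
rewrite /chordal_dist -[q]reprK !ph_mx_proj_scale ?nz//.
by apply: ler_sum => i _; apply: ler_sum => j _; exact: line_mx_diag_dist.
Qed.

End ProjectiveScaling.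

(** * Extraction of subsequences and a criterion for normality *)

Section Normality.
Variable R : realType.
Local Notation H := (quat R).

Lemma increasing_seq_ltn (s : nat -> nat) :
  increasing_seq s -> {homo s : a b / (a < b)%N}.
Proof. by move=> si a b; rewrite !ltnNge -!leEnat si. Qed.

Lemma increasing_seq_cvg_infty (s : nat -> nat) : increasing_seq s -> s @ \oo --> \oo.
Proof.
move=> si A [N _ NA]; exists N => // m /= Nm; apply: NA => /=.
apply: (leq_trans Nm); elim: m {Nm} => // m; move=> /leq_ltn_trans; apply.
exact: increasing_seq_ltn.
Qed.

(** Induction on the list: each step refines the subsequence for one more index, and the sequences
    treated earlier still converge along the refinement. *)
Lemma bolzano_weierstrass_seq (I : eqType) (r : seq I) (x : I -> nat -> R) :
  (forall i, bounded_fun (x i)) ->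
  exists2 s : nat -> nat, increasing_seq s & forall i, i \in r -> cvgn (x i \o s).
Proof.
move=> bx; elim: r => [|j r [s si sr]]; first by exists id.
have [|s' si' cs'] := @bolzano_weierstrass R (x j \o s).
  have [M [Mr MP]] := bx j; exists M; split => // y My k _.
  exact: (MP y My (s k)).
exists (s \o s') => [a b|i]; first by rewrite /= si -leEnat si'.
rewrite inE => /predU1P[->//|/sr ci].
apply: (@cvgP _ _ (lim (x i \o s @ \oo))).
exact: (cvg_comp _ _ (increasing_seq_cvg_infty si') ci).
Qed.

Lemma quatE (x : H) : x = qre x *: Quat 1 0 0 0 + qi x *: Quat 0 1 0 0 +
  qj x *: Quat 0 0 1 0 + qk x *: Quat 0 0 0 1.
Proof. by apply: quatP; split => /=; ring. Qed.

Definition quat_comp (c : 'I_4) (x : H) := [:: qre x; qi x; qj x; qk x]`_c.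

Lemma quat_comp_le (c : 'I_4) (x : H) : `|quat_comp c x| <= `|x|.
Proof.
rewrite -(@ler_pXn2r _ 2)// ?nnegrE// [leRHS]sqr_normq real_normK ?num_real//.
have s0 (y : R) : 0 <= y ^+ 2 by exact: sqr_ge0.
rewrite /normqsq /quat_comp; case: c => -[|[|[|[|//]]]] /= _;
have := (s0 (qre x), s0 (qi x), s0 (qj x), s0 (qk x)); move=> [[[]]]; lra.
Qed.

(** Extraction is applied simultaneously to the [4 * m] real components, each bounded by 1; the
    limits are then reassembled along the basis 1, i, j, k. *)
Lemma bounded_rV_cvg_subseq m (t : nat -> 'rV[H]_m) :
  (forall k i, `|t k 0 i| <= 1) ->
  exists2 s : nat -> nat, increasing_seq s &
  exists u : 'rV[H]_m, forall i, (fun k => t (s k) 0 i) @ \oo --> u 0 i.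
Proof.
move=> t1; pose x (ic : 'I_m * 'I_4) k := quat_comp ic.2 (t k 0 ic.1).
have [|s si cs] := @bolzano_weierstrass_seq _ (enum [set: 'I_m * 'I_4]) x.
  move=> ic; exists 1; split => // y y1 k _ /=.
  by rewrite (le_trans (quat_comp_le _ _))// (le_trans (t1 _ _))// ltW.
exists s => //.
have {}cs i (c : 'I_4) : x (i, c) \o s @ \oo --> limn (x (i, c) \o s).
  by apply: cs; rewrite mem_enum inE.
pose l i c := limn (x (i, c) \o s).
exists (\row_i (l i 0 *: Quat 1 0 0 0 + l i 1 *: Quat 0 1 0 0 +
  l i 2%:R *: Quat 0 0 1 0 + l i 3%:R *: Quat 0 0 0 1)) => i.
rewrite mxE; under eq_fun => k do rewrite (quatE (t (s k) 0 i)).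
by do 3?apply: cvgD; apply: cvgZr_tmp; exact: cs.
Qed.

Variable n : nat.
Local Notation P := (PH R n).

(** A coordinate that is bounded below on [U] and scaled by a factor of modulus 1 keeps the images
    of unit vectors away from 0. Limits of the diagonals inherit this, so convergence of the entries
    gives uniform convergence of the maps. *)
Lemma normal_proj_scale (U : set P) (F : set (U -> P)) (d : R) i0 i1 : 0 < d ->
  (forall q, U q -> d <= `|ph_mx q i0 i0|) ->
  (forall q, U q -> d <= `|ph_mx q i1 i1|) ->
  (forall f, F f -> exists t, [/\ f = sigL U (proj_scale t),
     forall i, `|t 0 i| <= 1 & `|t 0 i0| = 1 \/ `|t 0 i1| = 1]) ->
  normal_family F.
Proof.
move=> d0 U0 U1 FP f /(_ _)/FP/cid; move=> /all_sig[t ft].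
have [s si [u tu]] := @bounded_rV_cvg_subseq _ t (fun k => let: And3 _ h _ := ft k in h).
exists s; first exact: increasing_seq_ltn.
exists (sigL U (proj_scale u)).
have nt i : (fun k => `|t (s k) 0 i|) @ \oo --> `|u 0 i| by exact: cvg_norm (tu i).
have u1 i : `|u 0 i| <= 1.
  rewrite -(cvg_lim _ (nt i))//; apply: limr_le; first exact: cvgP (nt i).
  by apply: nearW => k; case: (ft (s k)).
have uU : `|u 0 i0| = 1 \/ `|u 0 i1| = 1.
  (* Which of the two moduli equals 1 may change with [k]; the product vanishes for every [k], hence
     in the limit. *)
  have c : (fun k => (1 - `|t (s k) 0 i0|) * (1 - `|t (s k) 0 i1|)) @ \oo -->
      (1 - `|u 0 i0|) * (1 - `|u 0 i1|).
    by apply: cvgM; apply: cvgB; (try exact: cvg_cst); exact: nt.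
  suff /eqP : (1 - `|u 0 i0|) * (1 - `|u 0 i1|) = 0.
    by rewrite mulf_eq0 !subr_eq0 => /orP[]/eqP <-; [left|right].
  rewrite -(cvg_lim _ c)//; under eq_fun => k.
    have -> : (1 - `|t (s k) 0 i0|) * (1 - `|t (s k) 0 i1|) = 0.
      by case: (ft (s k)) => _ _ [->|->]; rewrite subrr ?mul0r ?mulr0.
    over.
  by rewrite lim_cst.
have lb (v : 'rV[H]_n.+1) q : U q -> `|v 0 i0| = 1 \/ `|v 0 i1| = 1 ->
    d * vnsq (\val (repr q)) <= vnsq (diag_mx v *m \val (repr q)).
  move=> Uq v1; have w0 := vnsq_gt0 (valP (repr q)).
  have lbi i : `|v 0 i| = 1 -> d <= `|ph_mx q i i| ->
      d * vnsq (\val (repr q)) <= vnsq (diag_mx v *m \val (repr q)).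
    move=> vi; rewrite -{1}[q]reprK norm_ph_mx_diag ler_pdivlMr// => /le_trans; apply.
    rewrite (le_trans _ (coord_le_vnsq _ i))// diag_mx_coord norm_quatM vi mul1r//.
  by case: v1 => /lbi; apply; [exact: U0|exact: U1].
pose e k := \sum_i `|t (s k) 0 i - u 0 i|.
have e0 : e @ \oo --> (0 : R).
  rewrite (_ : 0 = \sum_(i < n.+1) 0); last by rewrite big1.
  apply: cvg_big => [|i _]; first exact: add_continuous.
  by apply/norm_cvg0P/subr_cvg0.
have {}e0 : (fun k => 4 * e k / d *+ n.+1 *+ n.+1) @ \oo --> (0 : R).
  pose c : R := 4 / d *+ n.+1 *+ n.+1.
  have ec : (fun k => c * e k) @ \oo --> c * (0 : R) by exact: cvgMl_tmp.
  rewrite mulr0 in ec; apply: cvg_trans ec; apply: near_eq_cvg; apply: nearW => k.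
  by rewrite /c !mulrnAl [in RHS]mulrAC.
(* The estimate is uniform on all of [U], hence on each compact subset. *)
apply/fam_cvgP => A _ B /uniform_nbhs[E [+ EB]].
rewrite -entourage_ballE => -[r r0 rE].
have er : \forall k \near \oo, 4 * e k / d *+ n.+1 *+ n.+1 < r by exact: cvgr_lt r0.
suff kB k : 4 * e k / d *+ n.+1 *+ n.+1 < r -> B (f (s k)) by exact: filterS er.
move=> ek; apply: EB => y _; apply: rE; rewrite /=.
have Uy : U (set_val y) by rewrite -inE; exact: (valP y).
have [fk tk1 tki] := ft (s k); rewrite fk.
apply: le_lt_trans ek; rewrite chordal_dist_sym.
apply: chordal_dist_proj_scale d0 tk1 u1 _ _ _ => [i||]; last first.
- exact: lb.
- exact: lb.
- by rewrite /e (bigD1 i)//= lerDl sumr_ge0.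
Qed.

End Normality.

(** * Obstruction to normality at points whose dominant coordinates vanish *)

Section Escape.
Variables (R : realType) (n : nat).
Local Notation H := (quat R).
Local Notation V := ('cV[quat R]_n.+1).
Local Notation P := (PH R n).

(** Normality concerns maps on the subtype [U], whereas test sets are built in the ambient space. A
    cluster point of the image filter lies in [K], hence in [U], and neighbourhoods in the subtype
    are traces of ambient ones. *)
Lemma compact_set_val_preimage (T : topologicalType) (U K : set T) :
  K `<=` U -> compact K -> compact (set_val @^-1` K : set U).
Proof.
move=> KU cK F FF FK.
have [x [Kx clx]] := cK (set_val @ F) _ FK.
have Ux : x \in U by rewrite inE; exact: KU.
exists (SigSub Ux : set_type U); split => // A B FA [C [[D oD DC] Cx CB]].
have FD : (set_val @ F) (set_val @` A).
  exact: (@filterS _ F _ A _ (fun y Ay => ex_intro2 _ _ y Ay erefl) FA).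
have Dx : D x by move: Cx; rewrite -DC.
have [_ [[y Ay <-] Dy]] := clx _ _ FD (open_nbhs_nbhs (conj oD Dx)).
by exists y; split => //; apply: CB; rewrite -DC.
Qed.

Lemma norm_quat1 : `|1 : H| = 1.
Proof. by rewrite norm_quatE /normqsq /= expr1n expr0n !addr0 sqrtr1. Qed.

Lemma norm_quatX (y : H) m : `|y ^+ m| = `|y| ^+ m.
Proof. by elim: m => [|m IH]; rewrite ?expr0 ?norm_quat1// !exprS norm_quatM IH. Qed.

Definition shift_coord (z : V) i (e : R) : V := \col_j (z j 0 + (e *+ (j == i))%:A).

(** Only a vanishing coordinate is altered, so some nonzero coordinate of [z] survives. *)
Lemma shift_coord_neq0 (z : V) i e : z != 0 -> z i 0 = 0 -> shift_coord z i e != 0.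
Proof.
move=> z0 zi; apply: contra_neq z0 => /matrixP zie; apply/matrixP => j k.
rewrite ord1 mxE; have := zie j 0; rewrite !mxE.
by case: eqVneq => [->|]; rewrite ?zi// mulr0n scale0r addr0.
Qed.

Lemma shift_coord_pi_continuous (z : nzvec R n) i
    (ze : forall e, shift_coord (\val z) i e != 0) :
  continuous (fun e => \pi_P (Sub (shift_coord (\val z) i e) (ze e) : nzvec R n)).
Proof.
move=> e0; apply: (@continuous_comp _ _ _ _ (\pi_P : nzvec R n -> P)); last exact: pi_continuous.
apply: continuous_comp_initial => {}e0 /=.
apply/cvg_mx_entourageP => E entE.
pose Ej j e := E (shift_coord (\val z) i e0 j 0, shift_coord (\val z) i e j 0).
have : \forall e \near e0, forall j, Ej j e.
  apply: (@filter_forall _ _ Ej (nbhs e0) (nbhs_filter e0)) => j.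
  have : (fun e => shift_coord (\val z) i e j 0) @ e0 --> shift_coord (\val z) i e0 j 0.
    under eq_fun do rewrite mxE; rewrite mxE; apply: cvgD; first exact: cvg_cst.
    apply: cvgZr_tmp; case: (j == i) => /=; last exact: cvg_cst.
    exact: cvg_id.
  by move/cvg_app_entourageP => /(_ _ entE).
apply: filterS => e eE j k; rewrite inE ord1; exact: eE.
Qed.

(* [phi] is the squared modulus of the normalised [i]-th coordinate.  Under the
   [m]-th power it tends to 1 along [x e] for every [e <> 0], but for fixed [m] it
   tends to 0 with [e]; uniform convergence on [K] makes both incompatible. *)
Lemma not_normal_powers (U : set P) (F : set (U -> P)) (t : 'rV[H]_n.+1)
    (z : nzvec R n) i :
  open U -> U (\pi_P z) -> (forall j, t 0 j != 0) ->
  (forall j, (\val z : V) j 0 != 0 -> `|t 0 j| < `|t 0 i|) ->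
  (forall m, F (sigL U (proj_scale (\row_j t 0 j ^+ m)))) ->
  ~ normal_family F.
Proof.
move=> oU Uz t0 zt Ft nF.
have zi : (\val z : V) i 0 = 0.
  by apply/eqP; apply: contraT => /zt; rewrite ltxx.
have ze e := shift_coord_neq0 e (valP z) zi.
pose x e : nzvec R n := Sub (shift_coord (\val z) i e) (ze e).
pose T m : 'rV[H]_n.+1 := \row_j t 0 j ^+ m.
(* The [m]-th power sends [x e] to a vector of squared norm [a m * e ^+ 2 + b m], where the first
   term comes from coordinate [i] alone. *)
pose a m := `|t 0 i| ^+ m ^+ 2.
pose b m := \sum_j `|t 0 j| ^+ m ^+ 2 * `|(\val z : V) j 0| ^+ 2.
have a0 m : 0 < a m by rewrite !exprn_gt0 ?normr_gt0.
have nv m e : vnsq (diag_mx (T m) *m \val (x e)) = a m * e ^+ 2 + b m.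
  rewrite vnsqE (bigD1 i)//= /b [in RHS](bigD1 i)//= zi normr0 expr0n mulr0 add0r.
  congr (_ + _).
    rewrite diag_mx_coord !mxE eqxx mulr1n zi add0r norm_quatM norm_quatX normrZ.
    by rewrite norm_quat1 mulr1 exprMn real_normK ?num_real.
  apply: eq_bigr => j /negPf ji; rewrite diag_mx_coord !mxE ji mulr0n scale0r addr0.
  by rewrite norm_quatM norm_quatX exprMn.
have Tx0 m (y : nzvec R n) : diag_mx (T m) *m \val y != 0.
  apply: contra_neq (valP y) => /matrixP Ty; apply/matrixP => j k.
  have := Ty j 0; rewrite ord1 diag_mx_coord mxE [in RHS]mxE.
  move=> /(congr1 Num.norm)/eqP; rewrite normr0 norm_quatM norm_quatX mulf_eq0.
  rewrite expf_eq0 !normr_eq0 => /orP[/andP[_ /eqP tj]|/eqP->]; last by rewrite mxE.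
  by case/eqP: (t0 j).
have b0 m : 0 < b m.
  have := vnsq_gt0 (Tx0 m (x 0)); by rewrite nv expr0n mulr0 add0r.
pose phi (q : P) := `|ph_mx q i i|.
have phiE m e : phi (proj_scale (T m) (\pi_P (x e))) = a m * e ^+ 2 / (a m * e ^+ 2 + b m).
  rewrite /phi proj_scale_pi norm_ph_mx_diag -nv /= diag_mx_coord.
  rewrite !mxE eqxx mulr1n zi add0r norm_quatM norm_quatX normrZ.
  by rewrite norm_quat1 mulr1 exprMn real_normK ?num_real.
have xc : continuous (fun e => \pi_P (x e)) := @shift_coord_pi_continuous z i ze.
have x0 : \pi_P (x 0) = \pi_P z.
  congr (\pi_P _); apply: val_inj; apply/matrixP => j k.
  by rewrite /= ord1 mxE mul0rn scale0r addr0.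
have [d d0 dU] : exists2 d : R, 0 < d & forall e, 0 <= e <= d -> U (\pi_P (x e)).
  have /nbhs_ballP[d /= d0 dU] : \forall e \near (0 : R), U (\pi_P (x e)).
    by have := open_nbhs_nbhs (conj oU Uz); rewrite -x0; exact: (xc 0 U).
  exists (d / 2); first by rewrite divr_gt0.
  move=> e /andP[e0 ed]; apply: dU; rewrite /ball /= sub0r normrN ger0_norm//.
  by rewrite (le_lt_trans ed)// ltr_pdivrMr// ltr_pMr// ltr1n.
pose K := (fun e => \pi_P (x e)) @` `[0, d].
have KU : K `<=` U by move=> _ [e /= e0d <-]; exact: dU.
have cK : compact K.
  apply: continuous_compact; last exact: segment_compact.
  exact: continuous_subspaceT.
have [s si [h cvh]] := nF _ Ft.
have {}cvh : {uniform (set_val @^-1` K : set U), (fun m => sigL U (proj_scale (T (s m)))) @ \oo --> h}.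
  exact: ((fam_cvgP _ _ _).1 cvh _ (compact_set_val_preimage KU cK)).
have {}si : increasing_seq s := leq_mono si.
have [N _ hN] : \forall m \near \oo, forall y : U, K (set_val y) ->
   chordal_dist (h y) (proj_scale (T (s m)) (set_val y)) < 1 / 4.
  apply: (cvh [set g | forall y : U, K (set_val y) -> chordal_dist (h y) (g y) < 1 / 4]).
  apply/uniform_nbhs.
  exists [set pq | chordal_ball pq.1 (1 / 4) pq.2]; split => [|g gE y Ky]; last exact: gE.
  rewrite -entourage_ballE; exists (1 / 4) => //=.
(* The bound [d] puts the point in [K]; the bound 1 gives [e ^+ 2 <= e]; the last bound then yields
   [a (s N) * e ^+ 2 <= b (s N) / 8], so [phi] is below 1/4 at the power [s N]. *)
pose e := Num.min d (Num.min 1 (b (s N) / (8 * a (s N)))).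
have e0 : 0 < e by rewrite !lt_min d0 ltr01 divr_gt0// mulr_gt0.
have Ke : K (\pi_P (x e)).
  by exists e => //=; rewrite in_itv/= ltW//= /e ge_min lexx.
have [y ye] : exists y : U, set_val y = \pi_P (x e).
  by exists (SigSub (mem_set (KU _ Ke)) : set_type U).
have lo : phi (h y) < 1 / 2.
  have := hN N (leqnn N) y; rewrite ye => /(_ Ke) dN.
  have := le_lt_trans (norm_ph_mx_dist _ _ i i) dN.
  rewrite -/(phi _) -/(phi _) phiE ltr_norml => /andP[_].
  set w := a (s N) * _ / _; suff : w < 1 / 4 by lra.
  rewrite /w ltr_pdivrMr; last first.
    by rewrite addr_gt0// mulr_gt0// exprn_gt0.
  have : a (s N) * e ^+ 2 <= b (s N) / 8.
    have e1 : e <= 1 by rewrite !ge_min lexx orbT.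
    apply: (@le_trans _ _ (a (s N) * e)).
      by rewrite ler_pM2l// expr2 ler_piMl// ltW.
    rewrite -ler_pdivlMl//.
    have -> : (a (s N))^-1 * (b (s N) / 8) = b (s N) / (8 * a (s N)).
      by field; rewrite gt_eqF.
    by rewrite !ge_min lexx !orbT.
  by have := b0 (s N); lra.
(* With [e] now fixed, larger powers bring [phi] above 3/4: the ratio [b m / a m] tends to 0, since
   every nonzero coordinate of [z] is scaled by a modulus strictly smaller than that of [t 0 i]. *)
have hi : 1 / 2 < phi (h y).
  pose c m := b m / a m.
  have c0 : c @ \oo --> (0 : R).
    have -> : c = fun m => \sum_j (`|t 0 j| / `|t 0 i|) ^+ m ^+ 2 * `|(\val z : V) j 0| ^+ 2.
      apply/funext => m; rewrite /c /b mulr_suml; apply: eq_bigr => j _.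
      by rewrite mulrAC /a !expr_div_n.
    rewrite [X in _ --> X](_ : 0 = \sum_(j < n.+1) (0 : R)); last by rewrite big1.
    apply: cvg_big => [|j _]; first exact: add_continuous.
    have [->|/zt tji] := eqVneq ((\val z : V) j 0) 0.
      by under eq_fun do rewrite normr0 expr0n mulr0; exact: cvg_cst.
    rewrite -[X in _ --> X](mul0r (`|(\val z : V) j 0| ^+ 2)); apply: cvgMr_tmp.
    rewrite -[X in _ --> X](mul0r (0 : R)); under eq_fun do rewrite expr2.
    apply: cvgM; apply: cvg_expr; rewrite normrM normfV !normr_id ltr_pdivrMr ?mul1r//;
      by rewrite normr_gt0.
  have [M _ hM] : \forall m \near \oo, c (s m) < e ^+ 2 / 4.
    have cs := cvg_comp _ _ (increasing_seq_cvg_infty si) c0.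
    by apply: (cvgr_lt _ cs); rewrite divr_gt0// exprn_gt0.
  (* Beyond [N] the power is within 1/4 of [h] at [y]; beyond [M] the ratio is small. *)
  pose m := maxn N M.
  have := hN m (leq_maxl _ _) y; rewrite ye => /(_ Ke) dm.
  have := le_lt_trans (norm_ph_mx_dist _ _ i i) dm.
  rewrite -/(phi _) -/(phi _) phiE ltr_norml => /andP[+ _].
  set w := a (s m) * _ / _; suff : 3 / 4 < w by lra.
  rewrite /w ltr_pdivlMr; last first.
    by rewrite addr_gt0// mulr_gt0// exprn_gt0.
  have := hM m (leq_maxr _ _); rewrite /c /= ltr_pdivrMr//.
  by rewrite mulrAC (mulrC (e ^+ 2)); have := b0 (s m); lra.
by have := lt_trans lo hi; rewrite ltxx.
Qed.
End Escape.

(** * Equicontinuity region of a cyclic group generated by a diagonal matrix *)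

Section DiagonalCyclic.
Variables (R : realType) (n : nat).
Local Notation H := (quat R).
Local Notation V := ('cV[quat R]_n.+1).
Local Notation P := (PH R n).
Local Notation G := (PSL R n.+1).
Implicit Types (t : 'rV[H]_n.+1).

Lemma pi_pslX (g : SL R n.+1) m : \pi_G (g ^+ m)%g = (\pi_G g ^+ m)%g.
Proof.
elim: m => [|m IH]; first by rewrite !expg0.
by rewrite !expgS (pi_pslM g) IH.
Qed.

Lemma slX_diag (g : SL R n.+1) (t : 'rV[H]_n.+1) m :
  slmx g = diag_mx t -> slmx (g ^+ m)%g = diag_mx (\row_j t 0 j ^+ m).
Proof.
move=> gt; elim: m => [|m IH].
  by apply/matrixP => i j; rewrite expg0 /= !mxE expr0.
rewrite expgS /= IH gt; apply/matrixP => i j; rewrite mul_diag_mx !mxE exprS.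
by rewrite mulrnAr.
Qed.

Lemma sl_diag_neq0 (g : SL R n.+1) (t : 'rV[H]_n.+1) j :
  slmx g = diag_mx t -> t 0 j != 0.
Proof.
move=> gt; have /matrixP/(_ j j) : slmx g *m slmx (g^-1)%g = 1%:M.
  exact: mulmxVH (detH_sl g).
rewrite gt mul_diag_mx !mxE eqxx => tj; apply/eqP => tj0.
by move/eqP: tj; rewrite tj0 mul0r eq_sym oner_eq0.
Qed.

Lemma slV_diag (g : SL R n.+1) (t : 'rV[H]_n.+1) :
  slmx g = diag_mx t -> slmx (g^-1)%g = diag_mx (\row_j (t 0 j)^-1).
Proof.
move=> gt; have gV : slmx g *m slmx (g^-1)%g = 1%:M by exact: mulmxVH (detH_sl g).
apply/matrixP => i j; move/matrixP/(_ i j) : gV.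
rewrite gt mul_diag_mx !mxE => /(congr1 ( *%R (t 0 i)^-1)).
by rewrite mulKr ?quat_unitE ?(sl_diag_neq0 _ gt)// => ->; rewrite mulr_natr.
Qed.

Lemma norm_quatV (x : H) : x != 0 -> `|x^-1| = `|x|^-1.
Proof.
move=> x0; apply: (mulfI (x := `|x|)); first by rewrite normr_eq0.
by rewrite -norm_quatM mulrV ?quat_unitE// norm_quat1 mulfV ?normr_eq0.
Qed.

(** Division by the largest modulus, a positive real number, leaves the projective action
    unchanged. *)
Lemma psl_act_normalized (g : SL R n.+1) (t : 'rV[H]_n.+1) i :
  slmx g = diag_mx t -> (forall j, `|t 0 j| <= `|t 0 i|) ->
  exists u, [/\ psl_act (\pi_G g) = proj_scale u,
    forall j, `|u 0 j| <= 1 & `|u 0 i| = 1].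
Proof.
move=> gt ti; have t0 := sl_diag_neq0 i gt.
have n0 : 0 < `|t 0 i| by rewrite normr_gt0.
exists (\row_j (`|t 0 i|^-1 *: t 0 j)); split => [|j|].
- apply/funext => q; apply: (psl_act_diag (a := `|t 0 i|)); first by rewrite gt_eqF.
  rewrite gt; congr diag_mx; apply/rowP => j.
  by rewrite !mxE scalerA mulfV ?gt_eqF// scale1r.
- by rewrite mxE normrZ normfV normr_id ler_pdivrMl ?mulr1.
- by rewrite mxE normrZ normfV normr_id mulVf ?gt_eqF.
Qed.

(** For the block form of the theorem, this predicate and the next one single out the indices of the
    last and of the first block. *)
Definition max_modulus (t : 'rV[H]_n.+1) i := forall j, `|t 0 j| <= `|t 0 i|.
Definition min_modulus (t : 'rV[H]_n.+1) i := forall j, `|t 0 i| <= `|t 0 j|.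

Definition coord_vanish (A : set 'I_n.+1) : set P :=
  [set \pi_P z | z in [set z : nzvec R n | forall i, A i -> (\val z : V) i 0 = 0]].

Lemma max_modulus_exists t : exists i, max_modulus t i.
Proof.
have [i _ ti] := @arg_maxP _ _ _ ord0 predT (fun i => `|t 0 i|) isT.
by exists i => j; exact: ti.
Qed.

(** Inversion reverses the order of the moduli, which reduces negative powers to positive powers of
    the inverse. *)
Lemma max_modulusV t i : (forall j, t 0 j != 0) ->
  max_modulus (\row_j (t 0 j)^-1) i <-> min_modulus t i.
Proof.
move=> t0; split => ti j; have := ti j; rewrite !mxE !norm_quatV//;
  by rewrite lef_pV2// posrE normr_gt0.
Qed.

Lemma coord_vanish_not_Eq (S : set G) (g : SL R n.+1) t q :
  slmx g = diag_mx t -> (forall m, S (\pi_G (g ^+ m)%g)) ->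
  coord_vanish (max_modulus t) q -> ~ Eq_region S q.
Proof.
move=> gt Sg [z zA <-] [U [oU Uz]].
have [i ti] := max_modulus_exists t.
apply: (not_normal_powers (i := i) oU Uz (fun j => sl_diag_neq0 j gt)).
(* An index [j] with modulus at least that of [t 0 i] is itself maximal, so the coordinate of [z]
   there vanishes. *)
- move=> j; apply: contra_neqT; rewrite -leNgt => tj; apply: zA => l.
  exact: le_trans (ti l) tj.
- move=> m; exists (\pi_G (g ^+ m)%g); first exact: Sg.
  congr sigL; apply/funext => q'.
  apply: (psl_act_diag (a := 1)); rewrite ?oner_eq0// (slX_diag m gt).
  by congr diag_mx; apply/rowP => j; rewrite !mxE scale1r.
Qed.

Lemma Eq_region_cyclic_diag (g : SL R n.+1) t : slmx g = diag_mx t ->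
  Eq_region (cyclic_group (\pi_G g)) =
  ~` (coord_vanish (max_modulus t) `|` coord_vanish (min_modulus t)).
Proof.
move=> gt; have t0 := fun j => sl_diag_neq0 j gt.
have gVt := slV_diag gt.
apply/seteqP; split => [q Eq [] zq|q].
- apply: (coord_vanish_not_Eq gt _ zq Eq) => m.
  by exists m; left; rewrite pi_pslX.
- apply: (coord_vanish_not_Eq gVt _ _ Eq) => [m|].
    by exists m; right; rewrite expVgn -pi_pslX; exact: pi_pslV.
  move: zq => [z zA <-]; exists z => // i /max_modulusV.
  by move=> /(_ t0); exact: zA.
move=> /not_orP[nM nm]; pose z := repr q.
have nz (A : set 'I_n.+1) : ~ coord_vanish A q -> exists2 i, A i & (\val z : V) i 0 != 0.
  move=> nA; apply: contra_notP nA => /forall2NP nA.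
  by exists z; rewrite ?reprK// => i Ai; have [//|/negP/negPn/eqP] := nA i.
have [i1 Mi1 zi1] := nz _ nM; have [i0 mi0 zi0] := nz _ nm.
pose phi i (q : P) := `|ph_mx q i i|.
have phi0 i : (\val z : V) i 0 != 0 -> 0 < phi i q.
  move=> zi; rewrite /phi -[q]reprK norm_ph_mx_diag divr_gt0 ?exprn_gt0 ?normr_gt0//.
  exact: vnsq_gt0 (valP z).
(* Each [phi i] varies by at most the chordal distance, so on the ball of radius [d] both functions
   stay at least [2 * d - d]. *)
pose d := Num.min (phi i0 q) (phi i1 q) / 2.
have d0 : 0 < d by rewrite divr_gt0// lt_min !phi0.
have dphi i w : d <= phi i q / 2 -> chordal_ball q d w -> d <= phi i w.
  move=> di qw; have := le_lt_trans (norm_ph_mx_dist q w i i) qw.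
  by rewrite -/(phi _ _) -/(phi _ _) ltr_norml; lra.
exists (ball q d)^°; split; first exact: open_interior.
  exact: (nbhsx_ballx q d d0).
apply: (@normal_proj_scale _ _ _ _ d i0 i1) => // [w /interior_subset|w /interior_subset|f].
- by apply: dphi; rewrite ler_pM2r// ge_min lexx.
- by apply: dphi; rewrite ler_pM2r// ge_min lexx orbT.
have ler_norm_quatX (x y : H) m : `|x| <= `|y| -> `|x ^+ m| <= `|y ^+ m|.
  by move=> xy; rewrite !norm_quatX; apply: lerXn2r; rewrite ?nnegrE.
(* Nonnegative powers are normalised at [i1], where the modulus is largest; inverse powers at [i0],
   where it is smallest. *)
move=> [_ [m [->|->]] <-].
- have [j|u [uE u1 ui]] := @psl_act_normalized _ _ i1 (slX_diag m gt).
    by rewrite !mxE; apply: ler_norm_quatX; exact: Mi1.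
  by exists u; split; [rewrite -uE pi_pslX| |right].
- have [j|u [uE u1 ui]] := @psl_act_normalized _ _ i0 (slX_diag m gVt).
    by rewrite !mxE; apply: ler_norm_quatX; have := (max_modulusV i0 t0).2 mi0 j; rewrite !mxE.
  exists u; split; [rewrite -uE|by []|by left].
  by rewrite pi_pslX -expVgn; congr (sigL _ (psl_act (_ ^+ _)%g)); exact/esym/pi_pslV.
Qed.

(** The vanishing set is itself a projective subspace containing the points; conversely, its vectors
    are right combinations of the basis vectors indexed by [A]. *)
Lemma lspan_std (A : set 'I_n.+1) :
  lspan [set std_point R i | i in A] = coord_vanish (~` A).
Proof.
apply/seteqP; split.
  apply: smallest_sub => [|_ [i Ai <-]].
    exists [set v : V | forall i, ~ A i -> v i 0 = 0] => //; split => /=.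
    - by move=> i _; rewrite mxE.
    - by move=> u v u0 v0 i Ai; rewrite mxE u0// v0// addr0.
    - by move=> v a v0 i Ai; rewrite mx11M v0// mul0r.
  eexists; last by [].
  by move=> j /= nAj; rewrite mxE; case: eqVneq => // ji; rewrite ji in nAj.
move=> _ [z zA <-] L [[W [W0 WD WM] ->] LA]; exists z => //=.
have -> : \val z = \sum_i delta_mx i 0 *m ((\val z : V) i 0)%:M :> V.
  apply/matrixP => j k; rewrite ord1 summxE (bigD1 j)//= big1 ?addr0.
    by rewrite mx11M mxE !eqxx mul1r.
  by move=> i ij; rewrite mx11M mxE eq_sym (negPf ij) mul0r.
apply: big_ind => // i _.
have [Ai|nAi] := pselect (A i); last by rewrite (zA _ nAi) raddf0 mulmx0.
(* The representative [w] found in [W] is only a right multiple of the basis vector; multiplying by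
   [a^-1] recovers the vector itself. *)
have /LA[w Ww /PHP/asboolP[a a0 wa]] : [set std_point R i | i in A] (std_point R i : P).
  by exists i.
apply: (WM); have -> : delta_mx i 0 = \val w *m (a^-1)%:M :> V.
  by rewrite wa -mulmxA -scalar_mxM mulrV ?mulmx1.
exact: WM.
Qed.

End DiagonalCyclic.

(** * Numbering of the blocks and passage from the block form to a diagonal *)

Section BlockIndex.
Variables (p N : nat) (k : 'I_p.+1 -> nat) (sum_k : (\sum_(i < p.+1) k i)%N = N).

(** The [tagnat] indexing is the one underlying [\mxdiag], so diagonal entries of the block matrix
    unfold directly to it. *)
Definition block_index (i : 'I_N) : 'I_p.+1 :=
  tagnat.sig1 (cast_ord (esym sum_k) i).

(** Position of the first index of block [b]; a natural number argument also allows [p.+1], the end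
    of the last block. *)
Let offset (b : nat) := (\sum_(j < p.+1 | (j < b)%N) k j)%N.

Let offsetS (b : 'I_p.+1) : offset b.+1 = (offset b + k b)%N.
Proof.
rewrite /offset (bigD1 b)//= [LHS]addnC; congr addn.
by apply: eq_bigl => j; rewrite ltnS [RHS]ltn_neqAle andbC.
Qed.

Let block_bounds (i : 'I_N) :
  (offset (block_index i) <= i < offset (block_index i).+1)%N.
Proof.
have := tagnat.rect (cast_ord (esym sum_k) i).
rewrite -/(block_index i) -/(offset _) /= => ->; rewrite leq_addr/=.
by rewrite offsetS ltn_add2l ltn_ord.
Qed.

Let offset_le b c : (b <= c)%N -> (offset b <= offset c)%N.
Proof.
move=> bc; rewrite /offset [leqRHS](bigID (fun j : 'I_p.+1 => (j < b)%N))/=.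
rewrite [X in (_ <= X + _)%N](eq_bigl (fun j : 'I_p.+1 => (j < b)%N)) ?leq_addr// => j.
by case: (ltnP j b) => jb; rewrite ?andbF// (leq_trans jb bc).
Qed.

Lemma block_index_min (i : 'I_N) : (block_index i == ord0) = (i < k ord0)%N.
Proof.
have /andP[lb ub] := block_bounds i.
have o1 : offset 1 = k ord0.
  by rewrite /offset (big_pred1 ord0)// => j; rewrite ltnS leqn0.
rewrite -val_eqE /=; case: (posnP (block_index i)) => [b0|b0].
  by rewrite b0 in ub; rewrite -o1 ub.
by apply/esym/negbTE; rewrite -leqNgt -o1 (leq_trans _ lb)// offset_le.
Qed.

Lemma block_index_max (i : 'I_N) :
  (block_index i == ord_max) = ~~ (i < \sum_(j < p) k (widen_ord (leqnSn p) j))%N.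
Proof.
have /andP[lb ub] := block_bounds i.
have op : offset p = (\sum_(j < p) k (widen_ord (leqnSn p) j))%N.
  rewrite /offset big_mkcond big_ord_recr /= ltnn addn0.
  by apply: eq_bigr => j _; rewrite ltn_ord.
rewrite -op -leqNgt -val_eqE /=.
have [bp|bp] := eqVneq (block_index i : nat) p; first by rewrite bp in lb; rewrite lb.
apply/esym/negbTE; rewrite -ltnNge (leq_trans ub)// offset_le//.
by rewrite ltn_neqAle bp -ltnS ltn_ord.
Qed.

Lemma block_index_surj (b : 'I_p.+1) : (0 < k b)%N -> exists i, block_index i = b.
Proof.
move=> kb; exists (cast_ord sum_k (tagnat.Rank b (Ordinal kb))).
by rewrite /block_index cast_ordK tagnat.Rank1K.
Qed.

End BlockIndex.

Lemma modulus_blocks_diag (R : realType) (p N : nat) (k : 'I_p.+1 -> nat)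
    (lam : 'I_p.+1 -> quat R) (D : forall i : 'I_p.+1, 'M[quat R]_(k i))
    (sum_k : (\sum_(i < p.+1) k i)%N = N) :
  (forall i, modulus_block `|lam i| (D i)) ->
  exists2 t : 'rV[quat R]_N,
    castmx (sum_k, sum_k) (\mxdiag_(i < p.+1) D i) = diag_mx t &
    forall i, `|t 0 i| = `|lam (block_index sum_k i)|.
Proof.
move=> Dl; set M := castmx _ _.
have dM : is_diag_mx M.
  apply/is_diag_mxP => i j ij; rewrite castmxE.
  suff /is_diag_mxP dD : is_diag_mx (\mxdiag_(i < p.+1) D i) by exact: dD.
  apply/is_diag_mxblockP; split => [a b ab|a]; first by rewrite (negPf ab).
  by rewrite eqxx conform_mx_id; have [] := Dl a.
exists (\row_i M i i) => [|i].
  apply/matrixP => i j; rewrite !mxE; case: eqVneq => [->|ij]; first by rewrite mulr1n.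
  by rewrite mulr0n; exact: (is_diag_mxP dM).
rewrite mxE /M castmxE /mxdiag mxE eqxx conform_mx_id.
by have [_] := Dl (block_index sum_k i); apply.
Qed.

(* The number of blocks is p.+1 (there is at least one since the sizes add up to
   n.+1); blocks and basis vectors are numbered from 0. *)
Theorem theorem5p1 (R : realType) (n p : nat)
    (tgamma : PSL R n.+1) (gamma : SL R n.+1)
    (k : 'I_p.+1 -> nat) (lam : 'I_p.+1 -> quat R)
    (D : forall i : 'I_p.+1, 'M[quat R]_(k i))
    (sum_k : (\sum_(i < p.+1) k i)%N = n.+1) :
  loxodromic tgamma ->
  \pi_(PSL R n.+1) gamma = tgamma ->
  (forall i, (0 < k i)%N) ->
  (forall i j : 'I_p.+1, (i < j)%N -> `|lam i| < `|lam j|) ->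
  (forall i, modulus_block `|lam i| (D i)) ->
  slmx gamma = castmx (sum_k, sum_k) (\mxdiag_(i < p.+1) D i) ->
  Eq_region (cyclic_group tgamma) =
    ~` (lspan [set std_point R i | i in
                [set i : 'I_n.+1 | (i < \sum_(j < p) k (widen_ord (leqnSn p) j))%N]]
        `|` lspan [set std_point R i | i in
                [set i : 'I_n.+1 | (k ord0 <= i)%N]]).
Proof.
move=> _ <- k0 lamlt Dlam gammaD.
have [t tD tlam] := modulus_blocks_diag sum_k Dlam.
have lamle (i j : 'I_p.+1) : (i <= j)%N -> `|lam i| <= `|lam j|.
  by rewrite leq_eqVlt => /predU1P[/val_inj->//|/lamlt/ltW].
(* The last block is nonempty, so its modulus is attained, and an index in any other block has
   strictly smaller modulus. *)
have maxE i : max_modulus t i <-> block_index sum_k i == ord_max.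
  split => [ti|/eqP bi j]; last by rewrite !tlam lamle// bi -ltnS ltn_ord.
  have [j bj] := block_index_surj sum_k (k0 ord_max).
  apply/negPn/negP => bi; have := ti j; rewrite !tlam bj leNgt lamlt//.
  by rewrite ltn_neqAle [X in X && _]bi -ltnS ltn_ord.
have minE i : min_modulus t i <-> block_index sum_k i == ord0.
  split => [ti|/eqP bi j]; last by rewrite !tlam lamle// bi.
  have [j bj] := block_index_surj sum_k (k0 ord0).
  apply/negPn/negP => bi; have := ti j; rewrite !tlam bj leNgt lamlt//.
  by rewrite lt0n.
rewrite (Eq_region_cyclic_diag (etrans gammaD tD)) !lspan_std.
(* The first span omits exactly the indices of the last block, the second exactly those of the first
   block. *)
congr (~` (coord_vanish _ `|` coord_vanish _)); apply/seteqP; split => i /=.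
- by move=> /maxE; rewrite block_index_max => /negP.
- by move=> /negP; rewrite -(block_index_max sum_k) => /maxE.
- by move=> /minE; rewrite block_index_min ltnNge => /negP.
- by move=> /negP; rewrite -ltnNge -(block_index_min sum_k) => /minE.
Qed.
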